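(* Let $\Gamma$ be a finite simple graph, let $d$ be a positive integer and let $v$ be a vertex of $\Gamma$. Then $\mathrm{Out}(A_\Gamma)$ can be virtually embedded into $\mathrm{Out}\bigl(A_{\Gamma^d_{\mathrm{st}(v)}}\bigr)$, i.e. there exist a finite-index subgroup $H\le\mathrm{Out}(A_\Gamma)$ and an injective group homomorphism $H\hookrightarrow\mathrm{Out}\bigl(A_{\Gamma^d_{\mathrm{st}(v)}}\bigr)$.
   Context: For a finite simple graph $\Gamma$ with vertex set $\mathrm{V}(\Gamma)$ and edge set $\mathrm{E}(\Gamma)$, the right-angled Artin group is $A_\Gamma=\langle \mathrm{V}(\Gamma)\mid vw=wv \text{ for all }\{v,w\}\in\mathrm{E}(\Gamma)\rangle$. $\mathrm{Out}(G)=\mathrm{Aut}(G)/\mathrm{Inn}(G)$. The star $\mathrm{st}(v)$ is the full (induced) subgraph of $\Gamma$ spanned by $v$ and all vertices adjacent to $v$. For a full subgraph $\Lambda$ of $\Gamma$, $\Gamma^d_\Lambda$ is the graph obtained from $d$ disjoint copies of $\Gamma$ by identifying all copies of $\Lambda$: $\Gamma^d_\Lambda=(\mathbb{Z}_d\times\Gamma)/\sim$, where distinct points $(a,x),(b,y)$ are identified if and only if $x=y\in\Lambda$; here $\mathbb{Z}_d$ is the cyclic group of order $d$. *)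

(* Defs.v *)
From HB Require Import structures.
From mathcomp Require Import all_boot.
From mathcomp Require Import boolp.

Set Implicit Arguments.
Unset Strict Implicit.
Unset Printing Implicit Defensive.

Import Algebra.
Local Open Scope group_scope.
Local Open Scope quotient_scope.

Record sgraph := SGraph {
  svertex :> finType;
  sedge : rel svertex;
  sedge_sym : symmetric sedge;
  sedge_irr : irreflexive sedge }.

(* A full subgraph is represented by its set of vertices. *)
Definition star (Gamma : sgraph) (v : Gamma) : {set Gamma} :=
  [set w | (w == v) || sedge v w].

Section MultipleAmalgam.
Variables (Gamma : sgraph) (d : nat) (Lambda : {set Gamma}).

(* Identifies all copies of the full subgraph spanned by Lambda.
   The d copies are indexed by 'I_d: only the cardinality of the index set
   matters, and 'Z_d has two elements for d = 1. *)
Definition amalgam_rel : rel ('I_d * Gamma) :=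
  fun p q => (p == q) || (p.2 == q.2) && (p.2 \in Lambda).

Fact amalgam_rel_refl : reflexive amalgam_rel.
Proof. by move=> p; rewrite /amalgam_rel eqxx. Qed.

Fact amalgam_rel_sym : symmetric amalgam_rel.
Proof.
move=> p q; rewrite /amalgam_rel eq_sym [p.2 == _]eq_sym.
by case: (q.2 =P p.2) => [->|].
Qed.

Fact amalgam_rel_trans : transitive amalgam_rel.
Proof.
move=> q p r; rewrite /amalgam_rel.
case: (p =P q) => [->//|_] /= /andP[/eqP epq pL].
case: (q =P r) => [<-|_] /=; first by rewrite epq -epq pL eqxx orbT.
by case/andP=> /eqP eqr _; rewrite epq eqr eqxx -eqr -epq pL orbT.
Qed.

Canonical amalgam_equiv :=
  EquivRel amalgam_rel amalgam_rel_refl amalgam_rel_sym amalgam_rel_trans.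

Definition amalgam_vertex := {eq_quot amalgam_rel}.
HB.instance Definition _ := Choice.on amalgam_vertex.
HB.instance Definition _ := EqQuotient.on amalgam_vertex.
HB.instance Definition _ :=
  Countable.copy amalgam_vertex (can_type (@reprK _ amalgam_vertex)).
HB.instance Definition _ : isFinite amalgam_vertex :=
  CanIsFinite (@reprK _ amalgam_vertex).

Definition amalgam_edge : rel amalgam_vertex := fun u w =>
  [exists a : 'I_d, exists x : Gamma, exists y : Gamma,
    [&& sedge x y, u == \pi_amalgam_vertex (a, x)
                 & w == \pi_amalgam_vertex (a, y)]].

Fact amalgam_edge_sym : symmetric amalgam_edge.
Proof.
suff imp u w : amalgam_edge u w -> amalgam_edge w u.
  by move=> u w; apply/idP/idP; apply: imp.
case/existsP=> a /existsP[x /existsP[y /and3P[xy ux wy]]].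
apply/existsP; exists a; apply/existsP; exists y; apply/existsP; exists x.
by rewrite sedge_sym xy wy ux.
Qed.

Fact amalgam_edge_irr : irreflexive amalgam_edge.
Proof.
move=> u; apply/negbTE/negP=> /existsP[a /existsP[x /existsP[y /and3P[xy /eqP-> ]]]].
rewrite eqmodE /= /amalgam_rel xpair_eqE eqxx /=.
have /negPf-> : x != y by apply: contraTneq xy => ->; rewrite sedge_irr.
by [].
Qed.

Definition amalgam : sgraph :=
  @SGraph amalgam_vertex amalgam_edge amalgam_edge_sym amalgam_edge_irr.

End MultipleAmalgam.

(* The letter (x, true) is the generator x and (x, false) its inverse. *)
Notation word X := (seq (X * bool)).

Section Presentation.
Variables (X : choiceType) (R : word X -> word X -> Prop).

Definition letter_inv (l : X * bool) : X * bool := (l.1, ~~ l.2).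
Definition word_inv (u : word X) : word X := rev (map letter_inv u).

Inductive pres_eq : word X -> word X -> Prop :=
| pres_eq_refl u : pres_eq u u
| pres_eq_sym u w : pres_eq u w -> pres_eq w u
| pres_eq_trans u w z : pres_eq u w -> pres_eq w z -> pres_eq u z
| pres_eq_cat u u' w w' :
    pres_eq u u' -> pres_eq w w' -> pres_eq (u ++ w) (u' ++ w')
| pres_eq_cancel l : pres_eq [:: l; letter_inv l] [::]
| pres_eq_rel u w : R u w -> pres_eq u w.

Definition pres_eqb : rel (word X) := fun u w => `[< pres_eq u w >].

Fact pres_eqb_refl : reflexive pres_eqb.
Proof. by move=> u; apply/asboolP/pres_eq_refl. Qed.

Fact pres_eqb_sym : symmetric pres_eqb.
Proof. by move=> u w; apply/asboolP/asboolP; apply: pres_eq_sym. Qed.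

Fact pres_eqb_trans : transitive pres_eqb.
Proof.
move=> w u z /asboolP uw /asboolP wz.
by apply/asboolP; apply: pres_eq_trans uw wz.
Qed.

Canonical pres_equiv :=
  EquivRel pres_eqb pres_eqb_refl pres_eqb_sym pres_eqb_trans.

Definition presented := {eq_quot pres_eqb}.
HB.instance Definition _ := Choice.on presented.
HB.instance Definition _ := EqQuotient.on presented.

Lemma presP (u w : word X) :
  \pi_presented u = \pi_presented w <-> pres_eq u w.
Proof.
split=> [/eqP | uw]; first by rewrite eqmodE => /asboolP.
by apply/eqP; rewrite eqmodE; apply/asboolP.
Qed.

Lemma pres_repr (u : word X) : pres_eq (repr (\pi_presented u)) u.
Proof. by apply/presP; rewrite reprK. Qed.

Lemma letter_invK : involutive letter_inv.
Proof. by case=> x b; rewrite /letter_inv /= negbK. Qed.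

Lemma word_invK : involutive word_inv.
Proof.
by move=> u; rewrite /word_inv map_rev revK -map_comp map_id_in // => l _ /=;
  rewrite letter_invK.
Qed.

Lemma pres_eq_mulV u : pres_eq (u ++ word_inv u) [::].
Proof.
elim: u => [|l u IH]; first exact: pres_eq_refl.
have -> : (l :: u) ++ word_inv (l :: u)
    = [:: l] ++ ((u ++ word_inv u) ++ [:: letter_inv l]).
  by rewrite /word_inv /= rev_cons -cats1 catA.
apply: pres_eq_trans (pres_eq_cancel l).
apply: (pres_eq_cat (u' := [:: l])); first exact: pres_eq_refl.
by apply: (pres_eq_cat (u' := [::])) => //; apply: pres_eq_refl.
Qed.

Lemma pres_eq_Vmul u : pres_eq (word_inv u ++ u) [::].
Proof. by have := pres_eq_mulV (word_inv u); rewrite word_invK. Qed.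

Lemma pres_eq_inv u w : pres_eq u w -> pres_eq (word_inv u) (word_inv w).
Proof.
move=> uw; apply: (@pres_eq_trans _ (word_inv u ++ (w ++ word_inv w))).
  rewrite -[X in pres_eq X _]cats0.
  apply: pres_eq_cat; first by apply: pres_eq_refl.
  exact/pres_eq_sym/pres_eq_mulV.
rewrite catA -[X in pres_eq _ X]cat0s.
apply: pres_eq_cat; last exact: pres_eq_refl.
apply: pres_eq_trans (pres_eq_Vmul u).
by apply: pres_eq_cat; [apply: pres_eq_refl | apply: pres_eq_sym].
Qed.

Definition pres_one : presented := \pi_presented [::].
Definition pres_mul (a b : presented) : presented :=
  \pi_presented (repr a ++ repr b).
Definition pres_inv (a : presented) : presented :=
  \pi_presented (word_inv (repr a)).

Lemma pres_mul_pi u w :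
  pres_mul (\pi_presented u) (\pi_presented w) = \pi_presented (u ++ w).
Proof. by apply/presP/pres_eq_cat; apply: pres_repr. Qed.

Lemma pres_inv_pi u : pres_inv (\pi_presented u) = \pi_presented (word_inv u).
Proof. by apply/presP/pres_eq_inv/pres_repr. Qed.

Fact pres_mulA : associative pres_mul.
Proof.
elim/quotW=> u; elim/quotW=> w; elim/quotW=> z.
by rewrite (pres_mul_pi w z) (pres_mul_pi u w) !pres_mul_pi catA.
Qed.

Fact pres_mul1 : left_id pres_one pres_mul.
Proof. by elim/quotW=> u; rewrite pres_mul_pi. Qed.

Fact pres_mulr1 : right_id pres_one pres_mul.
Proof. by elim/quotW=> u; rewrite pres_mul_pi cats0. Qed.

Fact pres_mulVg : left_inverse pres_one pres_inv pres_mul.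
Proof.
by elim/quotW=> u; rewrite pres_inv_pi pres_mul_pi; apply/presP/pres_eq_Vmul.
Qed.

Fact pres_mulgV : right_inverse pres_one pres_inv pres_mul.
Proof.
by elim/quotW=> u; rewrite pres_inv_pi pres_mul_pi; apply/presP/pres_eq_mulV.
Qed.

HB.instance Definition _ := isGroup.Build presented
  pres_mulA pres_mul1 pres_mulr1 pres_mulVg pres_mulgV.

End Presentation.

Definition raag_rel (Gamma : sgraph) (u w : word Gamma) : Prop :=
  exists x y : Gamma, [/\ sedge x y,
    u = [:: (x, true); (y, true)] & w = [:: (y, true); (x, true)]].

Definition raag (Gamma : sgraph) : groupType := presented (@raag_rel Gamma).

Section Automorphisms.
Variable G : groupType.

Record Aut := MkAut {
  aut_fun :> G -> G;
  autM : {morph aut_fun : x y / x * y};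
  aut_bij : bijective aut_fun }.

HB.instance Definition _ := gen_eqMixin Aut.
HB.instance Definition _ := gen_choiceMixin Aut.

Lemma autP (f g : Aut) : f =1 g -> f = g.
Proof.
case: f g => [f fM fb] [g gM gb] /= /funext fg; subst g.
by rewrite (Prop_irrelevance fM gM) (Prop_irrelevance fb gb).
Qed.

Definition aut_one : Aut :=
  @MkAut idfun (fun _ _ => erefl) (Bijective (fun=> erefl) (fun=> erefl)).

Fact aut_mulM (f g : Aut) : {morph f \o g : x y / x * y}.
Proof. by move=> x y /=; rewrite !autM. Qed.

Definition aut_mul (f g : Aut) : Aut :=
  MkAut (aut_mulM f g) (bij_comp (aut_bij f) (aut_bij g)).

Fact aut_inv_ex (f : Aut) : exists g : Aut, cancel f g /\ cancel g f.
Proof.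
have [g fK gK] := aut_bij f.
have gM : {morph g : x y / x * y}.
  by move=> x y; rewrite -{1}[x]gK -{1}[y]gK -autM fK.
by exists (MkAut gM (Bijective gK fK)).
Qed.

Definition aut_inv (f : Aut) : Aut := projT1 (cid (aut_inv_ex f)).

Lemma aut_invK (f : Aut) : cancel f (aut_inv f).
Proof. by rewrite /aut_inv; case: cid => g []. Qed.

Lemma aut_invKV (f : Aut) : cancel (aut_inv f) f.
Proof. by rewrite /aut_inv; case: cid => g []. Qed.

Fact aut_mulA : associative aut_mul.
Proof. by move=> f g h; apply: autP. Qed.

Fact aut_mul1 : left_id aut_one aut_mul.
Proof. by move=> f; apply: autP. Qed.

Fact aut_mulr1 : right_id aut_one aut_mul.
Proof. by move=> f; apply: autP. Qed.

Fact aut_mulVg : left_inverse aut_one aut_inv aut_mul.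
Proof. by move=> f; apply: autP => x /=; rewrite aut_invK. Qed.

Fact aut_mulgV : right_inverse aut_one aut_inv aut_mul.
Proof. by move=> f; apply: autP => x /=; rewrite aut_invKV. Qed.

HB.instance Definition _ := isGroup.Build Aut
  aut_mulA aut_mul1 aut_mulr1 aut_mulVg aut_mulgV.

Lemma aut_mulE (f g : Aut) x : (f * g) x = f (g x).
Proof. by []. Qed.

Fact inn_morph (g : G) : {morph (fun x => g * x * g^-1) : x y / x * y}.
Proof. by move=> x y /=; rewrite !mulgA mulgVK. Qed.

Fact inn_bij (g : G) : bijective (fun x => g * x * g^-1).
Proof.
exists (fun x => g^-1 * x * g) => x; rewrite /= !mulgA.
  by rewrite mulVg mul1g mulgVK.
by rewrite mulgV mul1g mulgK.
Qed.

Definition inn (g : G) : Aut := MkAut (@inn_morph g) (inn_bij g).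

Lemma innM (g h : G) : inn (g * h) = inn g * inn h.
Proof. by apply: autP => x; rewrite aut_mulE /= invgM !mulgA. Qed.

Lemma inn1 : inn 1 = 1.
Proof. by apply: autP => x /=; rewrite invg1 mul1g mulg1. Qed.

Lemma innV (g : G) : inn g^-1 = (inn g)^-1.
Proof. by apply: (mulgI (inn g)); rewrite -innM !mulgV inn1. Qed.

Lemma inn_conj (f : Aut) (g : G) : inn g * f = f * inn (aut_inv f g).
Proof.
have f1 : f 1 = 1 by apply: (mulgI (f 1)); rewrite -autM !mulg1.
have fV x : f x^-1 = (f x)^-1.
  by apply: (mulgI (f x)); rewrite -autM !mulgV.
by apply: autP => x; rewrite !aut_mulE /= !autM fV aut_invKV.
Qed.

(* Same left coset of Inn(G). *)
Definition out_rel : rel Aut := fun f g => `[< exists x, f = g * inn x >].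

Fact out_rel_refl : reflexive out_rel.
Proof. by move=> f; apply/asboolP; exists 1; rewrite inn1 mulg1. Qed.

Fact out_rel_sym : symmetric out_rel.
Proof.
suff imp f g : out_rel f g -> out_rel g f.
  by move=> f g; apply/idP/idP; apply: imp.
case/asboolP=> x ->; apply/asboolP; exists x^-1.
by rewrite innV mulgK.
Qed.

Fact out_rel_trans : transitive out_rel.
Proof.
move=> g f h /asboolP[x ->] /asboolP[y ->]; apply/asboolP.
by exists (y * x); rewrite innM mulgA.
Qed.

Canonical out_equiv := EquivRel out_rel out_rel_refl out_rel_sym out_rel_trans.

Definition Out := {eq_quot out_rel}.
HB.instance Definition _ := Choice.on Out.
HB.instance Definition _ := EqQuotient.on Out.

Lemma outP (f g : Aut) : \pi_Out f = \pi_Out g <-> exists x, f = g * inn x.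
Proof.
split=> [/eqP | fg]; first by rewrite eqmodE => /asboolP.
by apply/eqP; rewrite eqmodE; apply/asboolP.
Qed.

Definition out_one : Out := \pi_Out (1 : Aut).
Definition out_mul (a b : Out) : Out := \pi_Out (repr a * repr b).
Definition out_inv (a : Out) : Out := \pi_Out (repr a)^-1.

Lemma out_mul_pi (f g : Aut) :
  out_mul (\pi_Out f) (\pi_Out g) = \pi_Out (f * g).
Proof.
have /outP[x ef] := reprK (\pi_Out f); have /outP[y eg] := reprK (\pi_Out g).
rewrite /out_mul ef eg; apply/outP; exists (aut_inv g x * y).
by rewrite innM mulgA -[f * inn x * g]mulgA (inn_conj g x) !mulgA.
Qed.

Lemma out_inv_pi (f : Aut) : out_inv (\pi_Out f) = \pi_Out f^-1.
Proof.
have /outP[x ef] := reprK (\pi_Out f).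
rewrite /out_inv ef; apply/outP; exists (aut_inv f^-1 x^-1).
by rewrite invgM -innV inn_conj.
Qed.

Fact out_mulA : associative out_mul.
Proof.
by elim/quotW=> f; elim/quotW=> g; elim/quotW=> h;
  rewrite (out_mul_pi g h) (out_mul_pi f g) !out_mul_pi mulgA.
Qed.

Fact out_mul1 : left_id out_one out_mul.
Proof. by elim/quotW=> u; rewrite out_mul_pi mul1g. Qed.

Fact out_mulr1 : right_id out_one out_mul.
Proof. by elim/quotW=> u; rewrite out_mul_pi mulg1. Qed.

Fact out_mulVg : left_inverse out_one out_inv out_mul.
Proof. by elim/quotW=> u; rewrite out_inv_pi out_mul_pi mulVg. Qed.

Fact out_mulgV : right_inverse out_one out_inv out_mul.
Proof. by elim/quotW=> u; rewrite out_inv_pi out_mul_pi mulgV. Qed.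

HB.instance Definition _ := isGroup.Build Out
  out_mulA out_mul1 out_mulr1 out_mulVg out_mulgV.

End Automorphisms.

Section Subgroup.
Variables (G : groupType) (H : groupClosed G).

Definition subgroup := {x : G | x \in H}.
HB.instance Definition _ := SubChoice.on subgroup.

Fact subgroup_closed : group_closed (fun x : G => x \in H).
Proof. by split=> [|x y xH yH]; [rewrite unfold_in gpred1 | rewrite unfold_in gpredF]. Qed.

HB.instance Definition _ :=
  SubChoice_isSubGroup.Build G _ subgroup subgroup_closed.

End Subgroup.

(* Finitely many left cosets r * H cover G. *)
Definition finite_index (G : groupType) (H : groupClosed G) : Prop :=
  exists s : seq G, forall x : G, exists2 r, r \in s & r^-1 * x \in H.

Definition virtually_embeds (G K : groupType) : Prop :=
  exists H : groupClosed G, finite_index H /\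
    exists f : {multiplicative subgroup H -> K}, injective f.

(* Main.v *)
Require Import Defs.
From HB Require Import structures.
From mathcomp Require Import all_boot boolp.
From mathcomp Require Import ssralg ssrnum ssrint.
From mathcomp Require Import zify.

(** Write A for the group of Gamma and K for the group of the d-fold amalgam
    along st(v).  Let [cover : K -> A] send the copy of x with index a to
    v^a x v^-a when x <> v, and the common copy of v to v^d.  This is the
    classical identification of K with the kernel of the homomorphism from A
    to Z/d that counts the letters v: the coset space is written down as a
    right action of A on K x Z/d ([coset_act]), from which both injectivity
    ([cover_inj]) and the description of the image ([in_coverP]) can be read.

    So K is a normal subgroup of index d, and automorphisms of A preserving it
    restrict to K.  Two points make this descend to an embedding on outer
    automorphism groups.

    - An endomorphism of A that fixes K pointwise is the identity
      ([cover_fixed_pointwise]).  Indeed v^-1 f(v) commutes with every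
      generator x <> v and with v^d, and has degree zero in each generator.
      The centralizer of any positive power of a generator x lies in the
      subgroup generated by st(x) ([centralizer_gen_power]), so v^-1 f(v) is a
      product of generators that are central, and being of degree zero it is
      trivial ([central_up_to_powers_trivial]).  Hence an automorphism of A that
      restricts to an inner automorphism of K is itself inner.

    - Conversely, conjugation by v restricts to an automorphism of K that is in
      general not inner, so the restriction has to be limited to automorphisms
      among which the inner ones come from K.  This is achieved with an action
      of A on the finite set Z/d x bool ([flip_act]) that sees v as a rotation
      and every x outside st(v) as a flip located at 0.  The automorphisms f
      such that f(g) always acts as g does preserve K
      ([flip_invariant_cover]), and an inner one among them is conjugation by
      an element of K: the conjugating element commutes with the flip, so it
      does not rotate ([flip_invariant_inn]).  As A is finitely generated and
      the set is finite, they form a subgroup of finite index. *)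

Set Implicit Arguments.
Unset Strict Implicit.
Unset Printing Implicit Defensive.

Import Algebra.
Local Open Scope group_scope.
Local Open Scope quotient_scope.

(** * Homomorphisms and generators *)

Section Homs.
Variables (G H : groupType) (f : G -> H).
Hypothesis fM : {morph f : x y / x * y}.

Lemma hom1 : f 1 = 1.
Proof. by apply: (mulgI (f 1)); rewrite -fM !mulg1. Qed.

Lemma homV x : f x^-1 = (f x)^-1.
Proof. by apply: (mulgI (f x)); rewrite -fM !mulgV hom1. Qed.

Lemma homX x n : f (x ^+ n) = f x ^+ n.
Proof. by elim: n => [|n IH]; rewrite ?expg0 ?hom1 // !expgS fM IH. Qed.

End Homs.

Section Generators.
Variable Gamma : sgraph.

Definition gen (x : Gamma) : raag Gamma :=
  \pi_(presented (@raag_rel Gamma)) [:: (x, true)].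

Lemma genV x : (gen x)^-1 = \pi_(presented (@raag_rel Gamma)) [:: (x, false)].
Proof. exact: pres_inv_pi. Qed.

Lemma gen_edge x y : sedge x y -> commute (gen x) (gen y).
Proof.
move=> xy; rewrite /commute /gen.
rewrite [LHS]pres_mul_pi [RHS]pres_mul_pi; apply/presP/pres_eq_rel.
by exists x, y.
Qed.

(** Adding letters on the right suits right actions, for which the added letter
    is the one that acts last. *)
Lemma raag_ind (P : raag Gamma -> Prop) :
    P 1 -> (forall g x, P g -> P (g * gen x)) ->
    (forall g x, P g -> P (g * (gen x)^-1)) ->
  forall g, P g.
Proof.
move=> P1 Pp Pn; elim/quotW; elim/last_ind => [|u [x b] IH]; first exact: P1.
have -> : \pi_(presented (@raag_rel Gamma)) (rcons u (x, b))
   = (\pi_(presented (@raag_rel Gamma)) u : raag Gamma)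
     * (if b then gen x else (gen x)^-1).
  by rewrite -cats1; case: b; rewrite ?genV; symmetry; apply: pres_mul_pi.
by case: b; [apply: Pp | apply: Pn].
Qed.

Lemma raag_hom_ext (G : groupType) (f h : raag Gamma -> G) :
    {morph f : x y / x * y} -> {morph h : x y / x * y} ->
  (forall x, f (gen x) = h (gen x)) -> f =1 h.
Proof.
move=> fM hM fh; elim/raag_ind=> [|g x IH|g x IH]; first by rewrite !hom1.
  by rewrite fM hM IH fh.
by rewrite fM hM IH (homV fM) (homV hM) fh.
Qed.

Lemma commute_gens (h : raag Gamma) :
  (forall x, commute (gen x) h) -> forall g, commute g h.
Proof.
move=> hx; elim/raag_ind=> [|g x IH|g x IH].
- exact/commute_sym/commute1.
- by apply/commute_sym/commuteM; apply/commute_sym.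
- apply/commute_sym/commuteM; first exact/commute_sym.
  exact/commuteV/commute_sym.
Qed.

End Generators.

(** * Right actions of right-angled Artin groups *)

(** Most facts below come from following single points under an action given on
    generators.  With right actions, a homomorphism into a group G becomes an
    action on G that commutes with left translations. *)
Record raag_action (Gamma : sgraph) (T : Type) := RaagAction {
  fwd : Gamma -> T -> T;
  bwd : Gamma -> T -> T;
  fwdK : forall x, cancel (fwd x) (bwd x);
  bwdK : forall x, cancel (bwd x) (fwd x);
  fwdC : forall x y, sedge x y -> forall t, fwd x (fwd y t) = fwd y (fwd x t) }.

Section Action.
Variables (Gamma : sgraph) (T : Type) (a : raag_action Gamma T).

Definition letter_act (l : Gamma * bool) : T -> T :=
  if l.2 then fwd a l.1 else bwd a l.1.
Definition word_act (u : word Gamma) (t : T) : T :=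
  foldl (fun t l => letter_act l t) t u.
Definition ract (g : raag Gamma) (t : T) : T := word_act (repr g) t.

Lemma word_act_eq u w :
  pres_eq (@raag_rel Gamma) u w -> word_act u =1 word_act w.
Proof.
elim=> {u w} [//|u w _ IH t|u w z _ IH1 _ IH2 t
  |u u' w w' _ IH1 _ IH2 t|[x b] t|].
- by rewrite IH.
- by rewrite IH1 IH2.
- by rewrite /word_act !foldl_cat -/(word_act u t) IH1; apply: IH2.
- by case: b; rewrite /word_act /letter_act /= (fwdK, bwdK).
- move=> u w [x [y [xy -> ->]]] t.
  by rewrite /word_act /letter_act /= (fwdC a xy).
Qed.

Lemma ract_pi u : ract (\pi_(presented (@raag_rel Gamma)) u) =1 word_act u.
Proof. exact/word_act_eq/pres_repr. Qed.

Lemma ract1 t : ract 1 t = t.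
Proof. exact: ract_pi. Qed.

Lemma ractM g h t : ract (g * h) t = ract h (ract g t).
Proof.
by rewrite [g * h]/(pres_mul g h) ract_pi /word_act foldl_cat.
Qed.

Lemma ract_gen x t : ract (gen x) t = fwd a x t.
Proof. exact: ract_pi. Qed.

Lemma ractK g : cancel (ract g) (ract g^-1).
Proof. by move=> t; rewrite -ractM mulgV ract1. Qed.

Lemma ractVK g : cancel (ract g^-1) (ract g).
Proof. by move=> t; rewrite -ractM mulVg ract1. Qed.

Lemma ract_genV x t : ract (gen x)^-1 t = bwd a x t.
Proof. by apply: (can_inj (ractK (gen x))); rewrite ractVK ract_gen bwdK. Qed.

(** An automorphism acts through the images of the generators, so finitely many
    data determine how it changes an action on a finite set. *)
Lemma ract_ext (f h : raag Gamma -> raag Gamma) :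
    {morph f : x y / x * y} -> {morph h : x y / x * y} ->
    (forall x, ract (f (gen x)) =1 ract (h (gen x))) ->
  forall g, ract (f g) =1 ract (h g).
Proof.
move=> fM hM fh; elim/raag_ind=> [|g x IH|g x IH] t; first by rewrite !hom1.
  by rewrite fM hM !ractM IH fh.
rewrite fM hM !ractM IH (homV fM) (homV hM).
by apply: (can_inj (ractK (f (gen x)))); rewrite ractVK fh ractVK.
Qed.

End Action.

Lemma ract_equivariant (Gamma : sgraph) (T T' : Type)
    (a : raag_action Gamma T) (a' : raag_action Gamma T') (F : T -> T') :
    (forall x t, F (fwd a x t) = fwd a' x (F t)) ->
  forall g t, F (ract a g t) = ract a' g (F t).
Proof.
move=> Fx; elim/raag_ind=> [|g x IH|g x IH] t; first by rewrite !ract1.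
  by rewrite !ractM !ract_gen Fx IH.
rewrite !ractM -IH; apply: (can_inj (ractK a' (gen x))).
by rewrite ractVK ract_gen -Fx -(ract_gen a) ractVK.
Qed.

Section Lift.
Variables (Gamma : sgraph) (G : groupType) (s : Gamma -> G).
Hypothesis sC : forall x y, sedge x y -> commute (s x) (s y).

Definition mul_act : raag_action Gamma G.
Proof.
exists (fun x h => h * s x) (fun x h => h * (s x)^-1).
- by move=> x h; rewrite mulgK.
- by move=> x h; rewrite mulgVK.
- by move=> x y /sC xy h; rewrite -!mulgA xy.
Defined.

Definition raag_lift (g : raag Gamma) : G := ract mul_act g 1.

Lemma raag_lift_gen x : raag_lift (gen x) = s x.
Proof. by rewrite /raag_lift ract_gen /= mul1g. Qed.

Lemma mul_actE g h : ract mul_act g h = h * raag_lift g.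
Proof.
rewrite /raag_lift -{1}[h]mulg1.
rewrite -(ract_equivariant (a := mul_act) (F := fun t => h * t)) // => x t.
by rewrite /= mulgA.
Qed.

Lemma raag_liftM : {morph raag_lift : g h / g * h}.
Proof. by move=> g h; rewrite {1}/raag_lift ractM mul_actE. Qed.

End Lift.

(** * Retractions onto full subgraphs *)

Section Retraction.
Variable Gamma : sgraph.
Implicit Types P Q : pred Gamma.

Definition keep P x : raag Gamma := if P x then gen x else 1.

Lemma keep_edge P x y : sedge x y -> commute (keep P x) (keep P y).
Proof.
rewrite /keep => /gen_edge xy.
by case: (P x); case: (P y) => //; do ?[apply: commute1 | apply/commute_sym].
Qed.

Definition retr P : raag Gamma -> raag Gamma := raag_lift (@keep_edge P).

Lemma retrM P : {morph retr P : g h / g * h}.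
Proof. exact: raag_liftM. Qed.

Lemma retr_gen P x : retr P (gen x) = keep P x.
Proof. exact: raag_lift_gen. Qed.

Lemma retr_comp P Q g : retr P (retr Q g) = retr (predI P Q) g.
Proof.
apply: (raag_hom_ext (f := retr P \o retr Q)) => {g} [g h|g h|x] /=;
  rewrite ?retrM // !retr_gen /keep /=.
by case: (Q x); rewrite ?andbT ?andbF ?retr_gen ?(hom1 (@retrM P)).
Qed.

Lemma eq_retr P Q : P =1 Q -> retr P =1 retr Q.
Proof.
move=> PQ; apply: raag_hom_ext => [||x]; try exact: retrM.
by rewrite !retr_gen /keep PQ.
Qed.

Lemma retr_predT g : retr predT g = g.
Proof.
apply: (raag_hom_ext (h := id)) => // [|x]; first exact: retrM.
by rewrite retr_gen.
Qed.

Lemma retr_pred0 g : retr pred0 g = 1.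
Proof.
have: retr pred0 =1 fun=> 1 :> raag Gamma.
  apply: raag_hom_ext => [|x y|x]; first exact: retrM.
    by rewrite mulg1.
  by rewrite retr_gen.
exact.
Qed.

(** The retractions forgetting one generator each compose to the trivial
    retraction. *)
Lemma retr_all_but_one g : (forall y, g = retr (predC1 y) g) -> g = 1.
Proof.
move=> gy; have gs (s : seq Gamma) : g = retr [pred y | y \notin s] g.
  elim: s => [|y s IH].
    by rewrite -[LHS]retr_predT; apply: eq_retr.
  rewrite {1}(gy y) {1}IH retr_comp; apply: eq_retr => z /=.
  by rewrite inE negb_or.
by rewrite (gs (enum Gamma)) -[RHS](retr_pred0 g); apply: eq_retr => z;
  rewrite /= mem_enum.
Qed.

End Retraction.

(** * Centralizers of powers of generators *)

Section Centralizer.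
Variables (Gamma : sgraph) (x : Gamma).

(** The integer records the exponent of x read so far.  Up to exponent 0 the
    first component follows right multiplication; beyond it, the letters
    outside st(x) are ignored.  The letters of st(x) other than x commute with
    x, which makes this compatible with moving through the threshold, while
    all other letters may be treated independently on each level. *)
Definition threshold_act : raag_action Gamma (raag Gamma * int).
Proof.
exists
  (fun y (t : raag Gamma * int) =>
     if y == x then (t.1 * gen x, (t.2 + 1)%R)
     else (if (t.2 <= 0)%R || (y \in star x) then t.1 * gen y else t.1, t.2))
  (fun y (t : raag Gamma * int) =>
     if y == x then (t.1 * (gen x)^-1, (t.2 - 1)%R)
     else (if (t.2 <= 0)%R || (y \in star x) then t.1 * (gen y)^-1 else t.1,
           t.2)).
- move=> y [h i]; case: (y == x) => /=; first by rewrite mulgK GRing.addrK.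
  by case: (_ || _); rewrite ?mulgK.
- move=> y [h i]; case: (y == x) => /=; first by rewrite mulgVK GRing.subrK.
  by case: (_ || _); rewrite ?mulgVK.
- move=> y z yz [h i]; have yzC := gen_edge yz.
  case: (eqVneq y x) (yz) => [->|yx] xz;
    case: (eqVneq z x) (xz) => [->|zx] e //=.
  + have zs : z \in star x by rewrite inE e orbT.
    by rewrite zs !orbT -!mulgA -(gen_edge e).
  + have ys : y \in star x by rewrite inE sedge_sym e orbT.
    by rewrite ys !orbT -!mulgA (gen_edge e).
  + by case: (_ || _); case: (_ || _); rewrite // -!mulgA yzC.
Defined.

(** An element moves the integer by a bounded amount, so it acts by right
    multiplication when it starts far below the threshold, and through its
    retraction onto st(x) when it starts far above. *)
Lemma threshold_ract g : exists n : nat, forall h (i : int),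
  [/\ (i - n%:Z <= (ract threshold_act g (h, i)).2 <= i + n%:Z)%R,
      (i + n%:Z <= 0)%R -> (ract threshold_act g (h, i)).1 = h * g
    & (n%:Z < i)%R ->
        (ract threshold_act g (h, i)).1 = h * retr (mem (star x)) g].
Proof.
have xs : x \in star x by rewrite inE eqxx.
have rM := @retrM Gamma (mem (star x)).
elim/raag_ind: g => [|g y [n IH]|g y [n IH]].
- exists 0 => h i; rewrite ract1 /= (hom1 rM) mulg1; split=> //; lia.
- exists n.+1 => h i; rewrite ractM ract_gen.
  have [] := IH h i; case: (ract _ _ _) => h' j /= b1 e1 e2.
  rewrite rM retr_gen /keep /=.
  case: (eqVneq y x) => [->|yx] /=.
    rewrite xs; split=> [|c|c]; first lia.
      by rewrite e1 ?mulgA //; lia.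
    by rewrite e2 ?mulgA //; lia.
  split=> [|c|c]; first lia.
    rewrite ifT ?e1 ?mulgA //; lia.
  rewrite (_ : (j <= 0)%R = false) /=; last lia.
  by case: ifP => _; rewrite e2 ?mulg1 ?mulgA //; lia.
- exists n.+1 => h i; rewrite ractM ract_genV.
  have [] := IH h i; case: (ract _ _ _) => h' j /= b1 e1 e2.
  rewrite rM (homV rM) retr_gen /keep /=.
  case: (eqVneq y x) => [->|yx] /=.
    rewrite xs; split=> [|c|c]; first lia.
      by rewrite e1 ?mulgA //; lia.
    by rewrite e2 ?mulgA //; lia.
  split=> [|c|c]; first lia.
    rewrite ifT ?e1 ?mulgA //; lia.
  rewrite (_ : (j <= 0)%R = false) /=; last lia.
  by case: ifP => _; rewrite e2 ?invg1 ?mulg1 ?mulgA //; lia.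
Qed.

(** If g commutes with a large power p of x, then g p = p g acts on a point far
    below the threshold in two ways: on one side g is read before the jump
    across the threshold, on the other side after it. *)
Lemma centralizer_gen_power g n :
  0 < n -> commute g (gen x ^+ n) -> g = retr (mem (star x)) g.
Proof.
move=> n0 gC; have [l lP] := threshold_ract g.
have xX m h (i : int) :
    ract threshold_act (gen x ^+ m) (h, i) = (h * gen x ^+ m, (i + m%:Z)%R).
  elim: m h i => [|m IH] h i.
    by rewrite expg0 ract1 mulg1 GRing.addr0.
  rewrite expgS ractM ract_gen /= eqxx IH /= mulgA; congr (_, _); lia.
(* Starting from level -l, the jump by N = n(2l+1) ends above level l. *)
pose N := (n * l.*2.+1)%N.
have := commuteX l.*2.+1 gC; rewrite -expgnA -/N => gN.
have [_ e1 _] := lP 1 (- l%:Z)%R.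
have [_ _ e2] := lP (gen x ^+ N) (N%:Z - l%:Z)%R.
have := congr1 (fun h => (ract threshold_act h (1, (- l%:Z)%R)).1) gN.
rewrite !ractM xX mul1g GRing.addrC e2; last by rewrite /N; nia.
case E: (ract _ g _) e1 => [h' j] /= e1; rewrite xX /= e1; last lia.
by rewrite mul1g gN; apply: mulgI.
Qed.

End Centralizer.

(** * Degrees and central elements *)

Section Degree.
Variables (Gamma : sgraph) (y : Gamma).

Definition deg_act : raag_action Gamma int.
Proof.
exists (fun z i => (i + (z == y)%:Z)%R) (fun z i => (i - (z == y)%:Z)%R).
- by move=> z i; rewrite GRing.addrK.
- by move=> z i; rewrite GRing.subrK.
- by move=> z w _ i; rewrite GRing.addrAC.
Defined.

(** The exponent sum of y: acting on the integers by translations avoids the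
    need for a multiplicative copy of the group of integers. *)
Definition deg (g : raag Gamma) : int := ract deg_act g 0%R.

Lemma degM g h : deg (g * h) = (deg g + deg h)%R.
Proof.
rewrite {1}/deg ractM -/(deg g) -{1}[deg g]GRing.addr0 {2}/deg.
rewrite -(ract_equivariant (a := deg_act) (F := fun i => (deg g + i)%R)) //.
by move=> z i; rewrite /= GRing.addrA.
Qed.

Lemma deg1 : deg 1 = 0%R.
Proof. exact: ract1. Qed.

Lemma degX g n : deg (g ^+ n) = (n%:Z * deg g)%R.
Proof.
elim: n => [|n IH]; first by rewrite expg0 deg1 GRing.mul0r.
by rewrite expgS degM IH; nia.
Qed.

(** A central generator can be moved to the end of every word.  Stating this
    with two natural exponents avoids integral powers. *)
Lemma central_gen_split g : (forall h, commute h (gen y)) ->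
  exists m n : nat,
    g * gen y ^+ m = retr (predC1 y) g * gen y ^+ n /\ (deg g + m%:Z = n%:Z)%R.
Proof.
move=> yC; have rM := @retrM Gamma (predC1 y).
have yCX k h : h * gen y ^+ k = gen y ^+ k * h by apply: commuteX.
elim/raag_ind: g => [|g z [m [n [e d]]]|g z [m [n [e d]]]].
- by exists 0, 0; rewrite (hom1 rM) deg1.
- rewrite rM retr_gen /keep /= degM {2}/deg ract_gen /=.
  have [->|zy] /= := eqVneq z y.
    exists m, n.+1.
    rewrite mulg1 -mulgA -expgS expgSr mulgA e -mulgA -expgSr; split=> //; lia.
  exists m, n; rewrite -mulgA (yCX m) mulgA e -!mulgA (yCX n (gen z)).
  split=> //; lia.
- rewrite rM (homV rM) retr_gen /keep /= degM {2}/deg ract_genV /=.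
  have [->|zy] /= := eqVneq z y.
    exists m.+1, n; rewrite invg1 mulg1 -mulgA expgS mulKg e; split=> //; lia.
  exists m, n; rewrite -mulgA (yCX m) mulgA e -!mulgA (yCX n (gen z)^-1).
  split=> //; lia.
Qed.

Lemma central_gen_deg0 g : (forall h, commute h (gen y)) ->
  deg g = 0%R -> g = retr (predC1 y) g.
Proof.
move=> yC g0; have [m [n [e]]] := central_gen_split g yC.
rewrite g0 => mn; have {mn}mn : m = n by lia.
by move: e; rewrite mn; apply: mulIg.
Qed.

End Degree.

(** Every generator y can be forgotten without changing c: if y lies outside some
    st(x), because c is in the subgroup generated by st(x); otherwise because y
    is central and has exponent sum zero in c. *)
Lemma central_up_to_powers_trivial (Gamma : sgraph) (c : raag Gamma) :
    (forall x, exists2 n, 0 < n & commute c (gen x ^+ n)) ->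
    (forall x, deg x c = 0%R) ->
  c = 1.
Proof.
move=> cC c0; apply: retr_all_but_one => y.
have [/forallP ys|] := boolP [forall x, y \in star x].
  apply: central_gen_deg0 => //; apply: commute_gens => z.
  have := ys z; rewrite inE => /orP[/eqP->|/gen_edge//].
  exact: commute_refl.
rewrite negb_forall => /existsP[x yx].
have [n n0 cn] := cC x; rewrite {1 2}(centralizer_gen_power n0 cn) retr_comp.
apply: eq_retr => z /=; have [->|] := eqVneq z y; last by [].
exact/negbTE.
Qed.

(** * The amalgam along a star as a finite-index subgroup *)

Section Cover.
Variables (Gamma : sgraph) (n : nat) (v : Gamma).
Notation d := n.+1.
Notation A := (raag Gamma).
Notation Delta := (amalgam d (star v)).
Notation K := (raag Delta).

Definition copy (a : 'I_d) (x : Gamma) : Delta :=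
  \pi_(amalgam_vertex d (star v)) (a, x).

Lemma copy_star a b x : x \in star v -> copy a x = copy b x.
Proof.
by move=> xv; apply/eqP; rewrite eqmodE /= /amalgam_rel /= eqxx xv orbT.
Qed.

Lemma copy_edge a x y : sedge x y -> sedge (copy a x) (copy a y).
Proof.
move=> xy; apply/existsP; exists a; apply/existsP; exists x.
by apply/existsP; exists y; rewrite xy !eqxx.
Qed.

Lemma center_in_star : v \in star v.
Proof. by rewrite inE eqxx. Qed.

Lemma edge_star x : sedge v x -> x \in star v.
Proof. by rewrite inE orbC => ->. Qed.

(** The value on representatives; it does not depend on the copy when x lies in
    st(v), since x then commutes with v. *)
Definition cover_gen_at (p : 'I_d * Gamma) : A :=
  if p.2 == v then gen v ^+ d
  else gen v ^+ p.1 * gen p.2 * gen v ^- p.1.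

Definition cover_gen (q : Delta) : A :=
  cover_gen_at (repr (q : amalgam_vertex _ _)).

Lemma cover_gen_link a x : sedge v x -> cover_gen_at (a, x) = gen x.
Proof.
move=> vx; rewrite /cover_gen_at /=.
have -> : (x == v) = false by apply: contraTF vx => /eqP ->; rewrite sedge_irr.
have /commute_sym/commuteX vxC := gen_edge vx.
by rewrite -(vxC a) mulgK.
Qed.

Lemma cover_genE a x : cover_gen (copy a x) = cover_gen_at (a, x).
Proof.
rewrite /cover_gen.
have := reprK (copy a x : amalgam_vertex _ _).
case: (repr _) => b y /eqP; rewrite eqmodE /= /amalgam_rel.
case/orP=> [/eqP -> //|/= /andP[/eqP ->]].
rewrite inE => /orP[/eqP->|vx]; first by rewrite /cover_gen_at /= eqxx.
by rewrite !cover_gen_link.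
Qed.

Lemma cover_gen_edge p q : sedge p q -> commute (cover_gen p) (cover_gen q).
Proof.
case/existsP=> a /existsP[x /existsP[y /and3P[xy /eqP-> /eqP->]]].
rewrite !cover_genE.
case: (eqVneq x v) xy => [->|xv] xy.
  rewrite (cover_gen_link a xy) /cover_gen_at /= eqxx.
  exact/commute_sym/commuteX/commute_sym/gen_edge.
case: (eqVneq y v) xy => [->|yv]; rewrite sedge_sym => yx.
  rewrite (cover_gen_link a yx) /cover_gen_at /= eqxx.
  exact/commuteX/commute_sym/gen_edge.
rewrite /cover_gen_at /= (negPf xv) (negPf yv) /commute -!mulgA !mulKg.
by congr (_ * _); rewrite !mulgA (gen_edge yx).
Qed.

Definition cover : K -> A := raag_lift cover_gen_edge.

Lemma coverM : {morph cover : g h / g * h}.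
Proof. exact: raag_liftM. Qed.

Lemma cover_copy a x : cover (gen (copy a x)) = cover_gen_at (a, x).
Proof. by rewrite /cover raag_lift_gen cover_genE. Qed.

Definition center_copy : K := gen (copy ord0 v).

(** The pair (k, i) stands for the element cover(k) v^i of A, and a letter acts
    as right multiplication by that letter.  Reading v at the last level wraps
    around and produces the factor v^d, which is the image of
    [center_copy]. *)
Definition coset_act : raag_action Gamma (K * 'I_d).
Proof.
exists
  (fun x (t : K * 'I_d) =>
     if x == v
     then (t.1 * (if t.2 == ord_max then center_copy else 1), ordS t.2)
     else (t.1 * gen (copy t.2 x), t.2))
  (fun x (t : K * 'I_d) =>
     if x == v
     then (t.1 * (if ord_pred t.2 == ord_max then center_copy^-1 else 1),
           ord_pred t.2)
     else (t.1 * (gen (copy t.2 x))^-1, t.2)).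
- move=> x [k i]; case: (x == v) => /=; last by rewrite mulgK.
  by rewrite ordSK; case: ifP => _; rewrite ?mulgK ?mulg1.
- move=> x [k i]; case: (x == v) => /=; last by rewrite mulgVK.
  by rewrite ord_predK; case: ifP => _; rewrite ?mulgVK ?mulg1.
- have vC x k i : sedge v x ->
    k * gen (copy i x) * (if i == ord_max then center_copy else 1) =
    k * (if i == ord_max then center_copy else 1) * gen (copy (ordS i) x).
    move=> vx; rewrite (copy_star (ordS i) i (edge_star vx)) -!mulgA.
    congr (_ * _); case: ifP => _; last by rewrite mulg1 mul1g.
    rewrite /center_copy (copy_star ord0 i center_in_star).
    exact/gen_edge/copy_edge/(etrans (sedge_sym _ _) vx).
  move=> x y xy [k i].
  case: (eqVneq x v) (xy) => [->|xv] xz;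
    case: (eqVneq y v) (xz) => [->|yv] e //=.
  + by rewrite vC.
  + by rewrite vC // sedge_sym.
  + by rewrite -!mulgA (gen_edge (copy_edge i e)).
Defined.

Definition coset_val (t : K * 'I_d) : A := cover t.1 * gen v ^+ t.2.

Lemma coset_valE g t : coset_val (ract coset_act g t) = coset_val t * g.
Proof.
have idC x y : sedge x y -> commute (gen x : A) (gen y) by apply: gen_edge.
have -> : coset_val t * g = ract (mul_act idC) g (coset_val t).
  rewrite mul_actE; congr (_ * _); symmetry.
  apply: (raag_hom_ext (h := id)) => [|//|x]; first exact: raag_liftM.
  exact: raag_lift_gen.
apply: ract_equivariant => {g t} x [k i] /=; rewrite /coset_val.
case: (eqVneq x v) => [->|xv] /=; last first.
  rewrite coverM cover_copy /cover_gen_at /= (negPf xv).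
  by rewrite !mulgA mulgVK.
rewrite coverM -!mulgA -expgSr; congr (_ * _).
case: (eqVneq i ord_max) => [->|im].
  rewrite cover_copy /cover_gen_at /= eqxx modnn expg0 mulg1 //.
rewrite (hom1 coverM) mul1g modn_small //.
rewrite ltnS ltn_neqAle -ltnS ltn_ord andbT.
by apply: contraNneq im => e; apply/eqP/val_inj.
Qed.

Lemma coset_act_power k (a : 'I_d) :
  ract coset_act (gen v ^+ a) (k, ord0) = (k, a).
Proof.
case: a => /=; elim=> [|m IH] mn.
  by rewrite expg0 ract1; congr (_, _); apply: val_inj.
rewrite expgSr ractM (IH (ltnW mn)) ract_gen /= eqxx ifF.
  by rewrite mulg1; congr (_, _); apply: val_inj; rewrite /= modn_small.
by apply/negbTE/eqP => /(congr1 val) /= e; rewrite e ltnn in mn.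
Qed.

Lemma coset_act_cover_gen a x k :
  ract coset_act (cover_gen_at (a, x)) (k, ord0) = (k * gen (copy a x), ord0).
Proof.
rewrite /cover_gen_at /=; case: eqVneq => [->|xv].
  rewrite expgSr ractM (coset_act_power k ord_max) ract_gen /= !eqxx.
  rewrite /center_copy (copy_star ord0 a center_in_star); congr (_, _).
  by apply: val_inj; rewrite /= modnn.
rewrite !ractM coset_act_power ract_gen /= (negPf xv).
have := ractK coset_act (gen v ^+ a) (k * gen (copy a x), ord0).
by rewrite coset_act_power.
Qed.

(** The image of K acts on level 0 by right multiplication: this is what
    makes [cover] injective, without any normal form in A. *)
Lemma coset_act_cover k k' :
  ract coset_act (cover k) (k', ord0) = (k' * k, ord0).
Proof.
have qE (q : Delta) k1 :
    ract coset_act (cover (gen q)) (k1, ord0) = (k1 * gen q, ord0).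
  rewrite -(reprK (q : amalgam_vertex d (star v))).
  case: (repr _) => a x; rewrite -/(copy a x) cover_copy.
  exact: coset_act_cover_gen.
elim/raag_ind: k k' => [|k q IH|k q IH] k'.
- by rewrite (hom1 coverM) ract1 mulg1.
- by rewrite coverM ractM IH qE mulgA.
- rewrite coverM ractM IH (homV coverM).
  apply: (can_inj (ractK coset_act (cover (gen q)))).
  by rewrite ractVK qE mulgA mulgVK.
Qed.

Lemma cover_inj : injective cover.
Proof.
move=> k k' kk'; have := coset_act_cover k 1.
by rewrite kk' coset_act_cover !mul1g => -[].
Qed.

Definition turn_act : raag_action Gamma 'I_d.
Proof.
exists (fun x i => if x == v then ordS i else i)
       (fun x i => if x == v then ord_pred i else i).
- by move=> x i; case: (x == v); rewrite ?ordSK.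
- by move=> x i; case: (x == v); rewrite ?ord_predK.
- by move=> x y _ i; case: (x == v); case: (y == v).
Defined.

Lemma coset_decomp g : exists k, g = cover k * gen v ^+ (ract turn_act g ord0).
Proof.
have := coset_valE g (1, ord0).
have -> : ract turn_act g ord0 = (ract coset_act g (1, ord0)).2.
  rewrite (ract_equivariant (a' := turn_act) (F := snd)) // => x [k i] /=.
  by case: (x == v).
case: (ract _ _ _) => k i; rewrite /coset_val /= (hom1 coverM) expg0 !mul1g.
by move=> <-; exists k.
Qed.

Lemma cover_turn0 k : ract turn_act (cover k) ord0 = ord0.
Proof.
have -> : ract turn_act (cover k) ord0 = (ract coset_act (cover k) (1, ord0)).2.
  rewrite (ract_equivariant (a' := turn_act) (F := snd)) // => x [k' i] /=.
  by case: (x == v).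
by rewrite coset_act_cover.
Qed.

Lemma in_coverP g : (exists k, g = cover k) <-> ract turn_act g ord0 = ord0.
Proof.
split=> [[k ->]|g0]; first exact: cover_turn0.
by have [k ->] := coset_decomp g; exists k; rewrite g0 expg0 mulg1.
Qed.

(** The correction v^-1 f(v) is trivial because it commutes with some power of
    each generator: f fixes x and v x v^-1 for x <> v, as well as v^d. *)
Lemma cover_fixed_pointwise (f : A -> A) : {morph f : x y / x * y} ->
  (forall k, f (cover k) = cover k) -> f =1 id.
Proof.
move=> fM fK.
have fin g : ract turn_act g ord0 = ord0 -> f g = g.
  by case/in_coverP=> k ->.
have fx x : x != v -> f (gen x) = gen x.
  by move=> xv; apply: fin; rewrite ract_gen /= (negPf xv).
have fvd : f (gen v ^+ d) = gen v ^+ d.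
  have := fK (gen (copy ord0 v)).
  by rewrite cover_copy /cover_gen_at /= eqxx.
have fV : f (gen v) ^+ d = gen v ^+ d by rewrite -homX.
pose c := (gen v)^-1 * f (gen v).
suff c1 : c = 1.
  apply: raag_hom_ext => // x; case: (eqVneq x v) => [->|]; last exact: fx.
  by rewrite -[f _](mulVKg (gen v)) -/c c1 mulg1.
apply: central_up_to_powers_trivial => x; last first.
  have := congr1 (deg x) fV; rewrite !degX degM => e.
  have : deg x ((gen v)^-1 * gen v) = 0%R by rewrite mulVg deg1.
  rewrite degM; nia.
case: (eqVneq x v) => [->|xv].
  exists d => //; apply/commute_sym/commuteM; apply/commute_sym.
    exact/commute_sym/commuteV/commute_sym/commuteX.
  by rewrite -fV; apply: commuteX.
exists 1%N => //; rewrite expg1 /c.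
have : f (gen v * gen x * (gen v)^-1) = gen v * gen x * (gen v)^-1.
  apply: fin; rewrite !ractM !ract_gen ract_genV /= (negPf xv) eqxx.
  exact: ordSK.
rewrite !fM (homV fM) (fx _ xv) => e.
rewrite /commute; apply: (mulgI (gen v)); rewrite -!mulgA mulVKg.
by apply: (mulIg (f (gen v))^-1); rewrite -!mulgA mulgV mulg1 mulgA e !mulgA.
Qed.

(** The first coordinate recovers [turn_act], and only one of its points
    carries the flips: an element that rotates nontrivially therefore does not
    commute with the flip of any vertex outside st(v). *)
Definition flip_act : raag_action Gamma ('I_d * bool).
Proof.
pose b x (p : 'I_d * bool) :=
  (p.1, ((x \notin star v) && (p.1 == ord0)) (+) p.2).
exists
  (fun x p => if x == v then (ordS p.1, p.2) else b x p)
  (fun x p => if x == v then (ord_pred p.1, p.2) else b x p).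
- move=> x [i e]; case: (x == v) => /=; first by rewrite ordSK.
  by rewrite /b /= addKb.
- move=> x [i e]; case: (x == v) => /=; first by rewrite ord_predK.
  by rewrite /b /= addKb.
- move=> x y xy [i e].
  case: (eqVneq x v) (xy) => [->|xv] xz;
    case: (eqVneq y v) (xz) => [->|yv] e' //=.
  + by rewrite /b /= edge_star.
  + by rewrite /b /= edge_star // sedge_sym.
  + by rewrite /b /= addbCA.
Defined.

Lemma flip_turn g p : (ract flip_act g p).1 = ract turn_act g p.1.
Proof.
apply: (ract_equivariant (F := fst)) => x {p}[i e] /=.
by case: (x == v).
Qed.

Definition flip_invariant (f : A -> A) :=
  forall g p, ract flip_act (f g) p = ract flip_act g p.

Lemma flip_invariant_cover f :
  flip_invariant f -> forall k, exists k', f (cover k) = cover k'.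
Proof.
move=> ft k; apply/in_coverP.
by rewrite -(flip_turn _ (ord0, false)) ft flip_turn cover_turn0.
Qed.

(** If every vertex lies in st(v), then v is central and any element of A can be
    replaced by its component in K.  Otherwise g commutes, as far as [flip_act]
    can see, with the flip of a vertex x outside st(v), which moves exactly the
    two points over 0; hence g maps this pair to itself. *)
Lemma flip_invariant_inn g :
  flip_invariant (inn g) -> exists k, inn g = inn (cover k).
Proof.
move=> gt.
have [/forallP vC|] := boolP [forall x, x \in star v].
  have {}vC : forall h, commute h (gen v).
    apply: commute_gens => x; have := vC x; rewrite inE => /orP[/eqP->|vx].
      exact: commute_refl.
    exact/commute_sym/gen_edge.
  have [k ->] := coset_decomp g; exists k.
  move: (nat_of_ord _) => m; apply: autP => h /=.
  rewrite invgM !mulgA -(mulgA (cover k) _ h) -(commuteX m (vC h)).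
  by rewrite mulgA mulgK.
rewrite negb_forall => /existsP[x xv].
suff /in_coverP[k ->] : ract turn_act g ord0 = ord0 by exists k.
have xNv : (x == v) = false.
  by apply: contraNF xv => /eqP->; exact: center_in_star.
pose p := (ord0 : 'I_d, false).
have gC : ract flip_act (g * gen x) p = ract flip_act (gen x * g) p.
  by rewrite -[g * gen x](mulgVK g) ractM (gt (gen x)) -ractM.
rewrite -(flip_turn g p); apply/eqP/negP => /negP gp.
move: gC; rewrite !ractM !ract_gen /= xNv xv eqxx /=.
have -> : ((ract flip_act g p).1 == ord0) = false by exact/negbTE.
rewrite /= -surjective_pairing.
by move/(can_inj (ractK flip_act g)).
Qed.

Lemma flip_invariant1 : flip_invariant id. Proof. by []. Qed.

Lemma flip_invariantM f h :
  flip_invariant f -> flip_invariant h -> flip_invariant (f \o h).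
Proof. by move=> ft ht g p; rewrite /= ft ht. Qed.

Lemma flip_invariantV f h : cancel h f -> flip_invariant f -> flip_invariant h.
Proof. by move=> hK ft g p; rewrite -ft hK. Qed.

End Cover.

(** * Restriction of outer automorphisms *)

Section OutEmbedding.
Variables (Gamma : sgraph) (n : nat) (v : Gamma).
Notation d := n.+1.
Notation A := (raag Gamma).
Notation K := (raag (amalgam d (star v))).
Notation cover := (@cover Gamma n v).
Notation flip_invariant := (@flip_invariant Gamma n v).

Definition restricts_to (f : Aut A) (F : Aut K) : Prop :=
  flip_invariant f /\ forall k, cover (F k) = f (cover k).

Lemma flip_invariant_aut_inv (f : Aut A) :
  flip_invariant f -> flip_invariant (f^-1 : Aut A).
Proof. exact/flip_invariantV/aut_invKV. Qed.

Lemma restriction_exists (f : Aut A) :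
  flip_invariant f -> exists F, restricts_to f F.
Proof.
move=> ft; have [F FP] := choice (flip_invariant_cover ft).
have [F' F'P] := choice (flip_invariant_cover (flip_invariant_aut_inv ft)).
have FM : {morph F : x y / x * y}.
  by move=> x y; apply: cover_inj; rewrite -FP !coverM autM !FP.
have FK : cancel F F'.
  by move=> x; apply: cover_inj; rewrite -F'P -FP; apply: aut_invK.
have F'K : cancel F' F.
  by move=> x; apply: cover_inj; rewrite -FP -F'P; apply: aut_invKV.
by exists (MkAut FM (Bijective FK F'K)); split.
Qed.

Lemma restrictsM f F h H : restricts_to f F -> restricts_to h H ->
  restricts_to (f * h) (F * H).
Proof.
move=> [ft fF] [ht hH]; split; first exact: flip_invariantM.
by move=> k; rewrite !aut_mulE fF hH.
Qed.

(** Well-definedness and injectivity on classes: the forward direction uses that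
    invariant inner automorphisms come from K, the backward direction that
    automorphisms of A are determined by their restriction to K. *)
Lemma restriction_out f F h H : restricts_to f F -> restricts_to h H ->
  \pi_(Out A) f = \pi_(Out A) h <-> \pi_(Out K) F = \pi_(Out K) H.
Proof.
move=> [ft fF] [ht hH]; split=> /outP[g e]; apply/outP.
  have /flip_invariant_inn[k gk] : flip_invariant (inn g).
    have -> : inn g = h^-1 * f by rewrite e mulKg.
    exact: flip_invariantM (flip_invariant_aut_inv ht) ft.
  exists k; apply: autP => k'; apply: cover_inj.
  by rewrite fF e gk !aut_mulE hH /= !coverM (homV (@coverM _ _ _)).
exists (cover g).
have fix_cover k : (h * inn (cover g))^-1 (f (cover k)) = cover k.
  rewrite -fF e aut_mulE hH /= !coverM (homV (@coverM _ _ _)).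
  exact: (aut_invK (h * inn (cover g)) (cover k)).
have fixM := autM ((h * inn (cover g))^-1 * f).
have fix1 := cover_fixed_pointwise fixM fix_cover.
apply: autP => x; rewrite -[in RHS](fix1 x); symmetry.
exact: (aut_invKV (h * inn (cover g)) (f x)).
Qed.

Definition flip_invariant_out : {pred Out A} :=
  fun o => `[< exists2 f : Aut A, flip_invariant f & o = \pi_(Out A) f >].

Fact flip_invariant_out1 : 1 \in flip_invariant_out.
Proof. by apply/asboolP; exists (1 : Aut A); first exact: flip_invariant1. Qed.

Fact flip_invariant_outM :
  {in flip_invariant_out &, forall o p, o * p \in flip_invariant_out}.
Proof.
move=> o p /asboolP[f ft ->] /asboolP[h ht ->]; apply/asboolP.
by exists (f * h); [apply: flip_invariantM | apply: out_mul_pi].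
Qed.

Fact flip_invariant_outV :
  {in flip_invariant_out, forall o, o^-1 \in flip_invariant_out}.
Proof.
move=> o /asboolP[f ft ->]; apply/asboolP.
by exists f^-1; [apply: flip_invariant_aut_inv | apply: out_inv_pi].
Qed.

HB.instance Definition _ :=
  isMulClosed.Build _ flip_invariant_out flip_invariant_outM.
HB.instance Definition _ :=
  isMul1Closed.Build _ flip_invariant_out flip_invariant_out1.
HB.instance Definition _ :=
  isInvClosed.Build _ flip_invariant_out flip_invariant_outV.

Lemma flip_invariant_out_finite_index :
  finite_index (flip_invariant_out : groupClosed _).
Proof.
(* Inverses are encoded since f and h lie in the same left coset as soon as
   their inverses change the action in the same way. *)
pose code (f : Aut A) :=
  [ffun x => [ffun p => ract (@flip_act Gamma n v) (f (gen x)) p]].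
have rep_ex c : exists f : Aut A, (exists h, code h^-1 = c) -> code f^-1 = c.
  have [[h hc]|no] := pselect (exists h, code h^-1 = c); first by exists h.
  by exists 1.
have [rep repP] := choice rep_ex.
exists [seq \pi_(Out A) (rep c)
       | c <- enum {: {ffun Gamma -> {ffun 'I_d * bool -> 'I_d * bool}}}].
elim/quotW=> f.
exists (\pi_(Out A) (rep (code f^-1))).
  by apply: map_f; rewrite mem_enum.
have e := repP _ (ex_intro _ f erefl); move: (rep _) e => h e.
apply/asboolP; exists (h^-1 * f).
  move=> g p; rewrite aut_mulE -{2}[g](aut_invK f).
  apply: ract_ext => [||x {}p]; try exact: autM.
  by have /ffunP/(_ x) := e; rewrite !ffunE => /ffunP/(_ p); rewrite !ffunE.
by rewrite -out_mul_pi -out_inv_pi.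
Qed.

Lemma out_restriction_exists (o : subgroup flip_invariant_out) :
  exists F : Aut K, exists2 f, restricts_to f F & \pi_(Out A) f = val o.
Proof.
case: o => o /= /asboolP[f ft ->].
by have [F fF] := restriction_exists ft; exists F, f.
Qed.

Definition out_restriction (o : subgroup flip_invariant_out) : Out K :=
  \pi_(Out K) (projT1 (cid (out_restriction_exists o))).

Lemma out_restrictionE f F (o : subgroup flip_invariant_out) :
  restricts_to f F ->
  \pi_(Out A) f = val o -> out_restriction o = \pi_(Out K) F.
Proof.
rewrite /out_restriction; case: cid => F' /= [f' f'F' <-] fF ff'.
exact/(restriction_out f'F' fF)/esym.
Qed.

Fact out_restrictionM : {morph out_restriction : o p / o * p}.
Proof.
move=> o p.
have [F [f fF fo]] := out_restriction_exists o.
have [H [h hH hp]] := out_restriction_exists p.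
rewrite (out_restrictionE fF fo) (out_restrictionE hH hp).
rewrite (out_restrictionE (restrictsM fF hH)); first by rewrite -out_mul_pi.
by rewrite -out_mul_pi fo hp.
Qed.

HB.instance Definition _ :=
  isMultiplicative.Build _ _ out_restriction out_restrictionM.

Lemma out_restriction_inj : injective out_restriction.
Proof.
move=> o p.
have [F [f fF fo]] := out_restriction_exists o.
have [H [h hH hp]] := out_restriction_exists p.
rewrite (out_restrictionE fF fo) (out_restrictionE hH hp) => FH.
by apply: val_inj; rewrite -fo -hp; apply/(restriction_out fF hH).
Qed.

End OutEmbedding.

Theorem corollary3p2 (Gamma : sgraph) (d : nat) (v : Gamma) :
  0 < d ->
  virtually_embeds (Out (raag Gamma)) (Out (raag (amalgam d (star v)))).
Proof.
case: d => // n _.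
exists (flip_invariant_out n v : groupClosed _); split.
  exact: flip_invariant_out_finite_index.
by exists (@out_restriction Gamma n v); apply: out_restriction_inj.
Qed.
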